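(* Let $B>0$, and let $g$ be the Eguchi-Hanson metric $$g=\left(1-\frac{B}{r^4}\right)^{-1}\mathrm{d}r^{2}+r^{2}\left(\sigma_{1}^{2}+\sigma_{2}^{2}+\left(1-\frac{B}{r^4}\right)\sigma_{3}^{2}\right),$$ where $r\ge \sqrt[4]{B}$, $0\le\theta\le\pi$, $0\le\phi\le 2\pi$, $0\le\psi\le 2\pi$. Identify complex spinors with column vectors $\Phi=(\Phi_1,\Phi_2,\Phi_3,\Phi_4)^t$ of complex-valued functions by means of the orthonormal frame $e_1,\dots,e_4$ and the Clifford representation given in the context. Then the parallel spinors of $g$ (the spinors $\Phi$ with $\nabla_X\Phi=0$ for every tangent vector $X$) are complex constant spinors (that is, all components $\Phi_1,\dots,\Phi_4$ are constant), and they form a complex vector space of dimension $2$.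
   Context: The Cartan-Maurer forms in the Euler angles $\theta,\phi,\psi$ are $$\sigma_{1}=\tfrac12(\sin\psi\,\mathrm{d}\theta-\sin\theta\cos\psi\,\mathrm{d}\phi),\quad \sigma_{2}=\tfrac12(-\cos\psi\,\mathrm{d}\theta-\sin\theta\sin\psi\,\mathrm{d}\phi),\quad \sigma_{3}=\tfrac12(\mathrm{d}\psi+\cos\theta\,\mathrm{d}\phi).$$ Put $f=f(r)=\sqrt{1-B/r^4}$, so that $g=f^{-2}\mathrm{d}r^2+r^2(\sigma_1^2+\sigma_2^2+f^2\sigma_3^2)$. The orthonormal coframe is $e^1=f^{-1}\mathrm{d}r$, $e^2=r\sigma_1$, $e^3=r\sigma_2$, $e^4=rf\sigma_3$, with dual orthonormal frame $$e_{1}=f\partial_{r},\quad e_{2}=\tfrac{2}{r}\Big(\sin\psi\,\partial_{\theta}-\tfrac{\cos\psi}{\sin\theta}\partial_{\phi}+\tfrac{\cos\theta\cos\psi}{\sin\theta}\partial_{\psi}\Big),$$ $$e_{3}=\tfrac{2}{r}\Big(-\cos\psi\,\partial_{\theta}-\tfrac{\sin\psi}{\sin\theta}\partial_{\phi}+\tfrac{\cos\theta\sin\psi}{\sin\theta}\partial_{\psi}\Big),\quad e_{4}=\tfrac{2}{rf}\partial_{\psi}$$ (these coordinate expressions are valid for $r>\sqrt[4]{B}$, $0<\theta<\pi$). The underlying manifold is, topologically, $R_{\ge0}\times SU(2)/Z_2\cong R_{\ge 0}\times P_3$ with $P_3$ real projective 3-space. The complex spinor bundle has complex rank 4. Clifford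 multiplication by $e_i$ (with $e_i\cdot e_i=-1$) is given by the $2\times2$-block matrices $$e_1\mapsto\begin{pmatrix}0&I\\ -I&0\end{pmatrix},\quad e_2\mapsto\begin{pmatrix}0&M_2\\ M_2&0\end{pmatrix},\quad e_3\mapsto\begin{pmatrix}0&M_3\\ M_3&0\end{pmatrix},\quad e_4\mapsto\begin{pmatrix}0&M_4\\ M_4&0\end{pmatrix},$$ $$I=\begin{pmatrix}1&0\\ 0&1\end{pmatrix},\quad M_2=\begin{pmatrix}0&\mathrm{i}\\ \mathrm{i}&0\end{pmatrix},\quad M_3=\begin{pmatrix}0&-1\\ 1&0\end{pmatrix},\quad M_4=\begin{pmatrix}\mathrm{i}&0\\ 0&-\mathrm{i}\end{pmatrix}.$$ The spin connection is $\nabla_{e_k}\Phi=e_k\Phi+\frac14\sum_{i,j=1}^4 g(\nabla_{e_k}e_i,e_j)\,e_i\cdot e_j\cdot\Phi$ (with the Levi-Civita connection inside $g(\cdot,\cdot)$ and $e_k\Phi$ the componentwise derivative). Explicitly, with $f'=\mathrm{d}f/\mathrm{d}r$, $$\nabla_{e_1}\Phi=e_1\Phi,\quad \nabla_{e_2}\Phi=e_2\Phi+\tfrac{f}{2r}(e_1\cdot e_2-e_3\cdot e_4)\cdot\Phi,\quad \nabla_{e_3}\Phi=e_3\Phi+\tfrac{f}{2r}(e_1\cdot e_3+e_2\cdot e_4)\cdot\Phi,$$ $$\nabla_{e_4}\Phi=e_4\Phi+\tfrac12\Big(\big(\tfrac{f}{r}+f'\big)e_1\cdot e_4+\big(\tfrac{f}{r}-\tfrac{2}{rf}\big)e_2\cdot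 e_3\Big)\cdot\Phi.$$ *)

(* Defs.v *)
From HB Require Import structures.
From mathcomp Require Import all_boot all_order all_algebra.
From mathcomp Require Import complex.
From mathcomp Require Import all_classical all_reals all_analysis.

Set Implicit Arguments.
Unset Strict Implicit.
Unset Printing Implicit Defensive.

Import Order.TTheory GRing.Theory Num.Theory.
Import numFieldNormedType.Exports.

Local Open Scope classical_set_scope.
Local Open Scope ring_scope.

(* [S] is a linear subspace of dimension [n]: it has a basis of [n] vectors. *)
Definition subspace_of_dim (K : fieldType) (V : lmodType K) (S : set V)
    (n : nat) : Prop :=
  exists b : 'I_n -> V,
    (forall c : 'I_n -> K, \sum_i c i *: b i = 0 -> forall i, c i = 0) /\
    (forall v, S v <-> exists c : 'I_n -> K, v = \sum_i c i *: b i).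

Section LeviCivita.
Variables (R : realType) (n : nat).

(* Points, tangent vectors and one-forms are rows of components in a chart of
   R^n; a metric is the field of its Gram matrices. *)
Implicit Types (G : 'rV[R]_n -> 'M[R]_n) (X : 'rV[R]_n) (p : 'rV[R]_n).

Definition partial (F : 'rV[R]_n -> R) (i : 'I_n) (p : 'rV[R]_n) : R :=
  'D_(delta_mx 0 i : 'rV[R]_n) F p.

Definition inner G p X (Y : 'rV[R]_n) : R := (X *m G p *m Y^T) 0 0.

(* Gamma^k_{ij} *)
Definition christoffel G (k i j : 'I_n) p : R :=
  2^-1 * \sum_l invmx (G p) k l *
    (partial (fun q => G q j l) i p + partial (fun q => G q i l) j p
     - partial (fun q => G q i j) l p).

Definition levi_civita G X (Y : 'rV[R]_n -> 'rV[R]_n) p : 'rV[R]_n :=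
  \row_k ('D_X (fun q => Y q 0 k) p
          + \sum_i \sum_j christoffel G k i j p * X 0 i * Y p 0 j).

End LeviCivita.

Section Clifford.
Variable R : realType.
Local Notation C := R[i].

Definition mx2 (a b c d : C) : 'M[C]_2 :=
  \matrix_(i, j) nth 0 (nth [::] [:: [:: a; b]; [:: c; d]] i) j.

Definition cM2 : 'M[C]_2 := mx2 0 'i 'i 0.
Definition cM3 : 'M[C]_2 := mx2 0 (-1) 1 0.
Definition cM4 : 'M[C]_2 := mx2 'i 0 0 (- 'i).

(* [clifford k] is Clifford multiplication by the frame vector of index [k],
   indices running from 0 to 3 instead of 1 to 4. *)
Definition clifford (k : 'I_4) : 'M[C]_4 :=
  nth 0 [:: block_mx 0 1%:M (- 1%:M) 0;
            block_mx 0 cM2 cM2 0;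
            block_mx 0 cM3 cM3 0;
            block_mx 0 cM4 cM4 0 : 'M[C]_(2 + 2)] k.

End Clifford.

Section EguchiHanson.
Variables (R : realType) (B : R).
Local Notation C := R[i].
Local Notation coords := 'rV[R]_4.

Definition row4 (a b c d : R) : 'rV[R]_4 := \row_j nth 0 [:: a; b; c; d] j.

Definition rcoord (p : coords) : R := p 0 (inord 0).
Definition theta (p : coords) : R := p 0 (inord 1).
Definition phi (p : coords) : R := p 0 (inord 2).
Definition psi (p : coords) : R := p 0 (inord 3).

Definition eh_f (r : R) : R := Num.sqrt (1 - B / r ^+ 4).

Definition sigma1 (p : coords) : 'rV[R]_4 :=
  2^-1 *: row4 0 (sin (psi p)) (- (sin (theta p) * cos (psi p))) 0.
Definition sigma2 (p : coords) : 'rV[R]_4 :=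
  2^-1 *: row4 0 (- cos (psi p)) (- (sin (theta p) * sin (psi p))) 0.
Definition sigma3 (p : coords) : 'rV[R]_4 :=
  2^-1 *: row4 0 0 (cos (theta p)) 1.

(* The symmetric square of a one-form, as a Gram matrix. *)
Definition sqform (a : 'rV[R]_4) : 'M[R]_4 := a^T *m a.

Definition eh_metric (p : coords) : 'M[R]_4 :=
  (1 - B / rcoord p ^+ 4)^-1 *: sqform (row4 1 0 0 0)
  + rcoord p ^+ 2 *: (sqform (sigma1 p) + sqform (sigma2 p)
                   + (1 - B / rcoord p ^+ 4) *: sqform (sigma3 p)).

(* The full coordinate range, boundary included. *)
Definition eh_domain : set coords :=
  [set p | [/\ B `^ 4^-1 <= rcoord p,
               0 <= theta p <= pi,
               0 <= phi p <= 2 * pi &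
               0 <= psi p <= 2 * pi] ].

(* The open part of the range, where the coordinate expressions of the metric
   and of the frame are nondegenerate. *)
Definition eh_chart : set coords :=
  [set p | [/\ B `^ 4^-1 < rcoord p,
               0 < theta p < pi,
               0 < phi p < 2 * pi &
               0 < psi p < 2 * pi] ].

Definition eh_frame (k : 'I_4) (p : coords) : 'rV[R]_4 :=
  let: r := rcoord p in let: t := theta p in let: s := psi p in
  nth 0
    [:: row4 (eh_f r) 0 0 0;
        (2 / r) *: row4 0 (sin s) (- (cos s / sin t)) (cos t * cos s / sin t);
        (2 / r) *: row4 0 (- cos s) (- (sin s / sin t)) (cos t * sin s / sin t);
        (2 / (r * eh_f r)) *: row4 0 0 0 1] k.

(* Spinors, identified with C^4-valued functions through the frame. *)
Definition spinor : Type := eh_domain -> 'cV[C]_4.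

(* Real and imaginary parts of the components, extended by 0 outside
   [eh_domain]. *)
Definition re_comp (Phi : spinor) (a : 'I_4) (p : coords) : R :=
  complex.Re ('valL_(0 : 'cV[C]_4) Phi p a 0).
Definition im_comp (Phi : spinor) (a : 'I_4) (p : coords) : R :=
  complex.Im ('valL_(0 : 'cV[C]_4) Phi p a 0).

Definition spinor_deriv (X : 'rV[R]_4) (Phi : spinor) (p : coords) : 'cV[C]_4 :=
  \col_a ('D_X (re_comp Phi a) p +i* 'D_X (im_comp Phi a) p)%C.

(* Covariant derivative along the tangent vector [X] at [p]. *)
Definition spin_connection (X : 'rV[R]_4) (Phi : spinor) (p : coords)
    : 'cV[C]_4 :=
  spinor_deriv X Phi p
  + 4^-1 *: \sum_i \sum_j
      (inner eh_metric p (levi_civita eh_metric X (eh_frame i) p)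
             (eh_frame j p))%:C%C
      *: (clifford R i *m clifford R j *m 'valL_(0 : 'cV[C]_4) Phi p).

(* Continuity up to the boundary ties the boundary values to the interior. *)
Definition regular_spinor (Phi : spinor) : Prop :=
  forall a : 'I_4,
    [/\ {within eh_domain, continuous (re_comp Phi a)},
        {within eh_domain, continuous (im_comp Phi a)},
        (forall p, eh_chart p -> differentiable (re_comp Phi a) p) &
        (forall p, eh_chart p -> differentiable (im_comp Phi a) p)].

Definition parallel_spinor : set spinor :=
  [set Phi | regular_spinor Phi /\
     forall p, eh_chart p -> forall X, spin_connection X Phi p = 0].

Definition constant_spinor (Phi : spinor) : Prop :=
  forall a : 'I_4, exists c : C, forall p, Phi p a 0 = c.

End EguchiHanson.

(* Main.v *)
Require Import Defs.
From HB Require Import structures.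
From mathcomp Require Import all_boot all_order all_algebra.
From mathcomp Require Import complex.
From mathcomp Require Import all_classical all_reals all_analysis.
From mathcomp Require Import ring lra.

Set Implicit Arguments.
Unset Strict Implicit.
Unset Printing Implicit Defensive.

Import Order.TTheory GRing.Theory Num.Theory.
Import numFieldNormedType.Exports.

Local Open Scope classical_set_scope.
Local Open Scope ring_scope.

(** A parallel spinor satisfies a first-order linear system whose coefficients
    are the connection forms [w_ij(X) = g(nabla_X e_i, e_j)] of the frame.
    They are found without inverting the metric: for an orthonormal coframe
    [T_i] dual to [e_i], Koszul's formula becomes
      [2 w_ij(X) = dT_i(X, e_j) - dT_j(X, e_i) + sum_m T_m(X) dT_m(e_i, e_j)]
    (lemma [connection_form]), and the exterior derivatives of
    [dr / f, r sigma_1, r sigma_2, r f sigma_3] follow from the Maurer-Cartan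
    equations [d sigma_1 = 2 sigma_2 /\ sigma_3] and its cyclic permutations
    (lemma [structure_equations]).

    The resulting matrix of connection forms is anti-self-dual (lemma
    [eh_connectionE]); this is where the special profile [f^2 = 1 - B / r^4]
    enters, through [f / r + f' = (2 - f^2) / (r f)].  Clifford multiplication
    by an anti-self-dual two-form vanishes on the first two components and acts
    by a 2 x 2 matrix on the last two (lemma [clifford_asd]), so

    - on [(Phi_1, Phi_2)] the spin connection is plain differentiation;
    - on [(Phi_3, Phi_4)] it is differentiation minus
      [f sigma_1 M_2 + f sigma_2 M_3 + (2 - f^2) sigma_3 M_4].

    Hence [Phi_1] and [Phi_2] have zero derivative on the open chart.  For the
    other pair, the radial equation says that [Phi_3] and [Phi_4] do not
    depend on [r], whereas the equation along [psi],
      [d Phi / d psi = (2 - f(r)^2) / 2 * M_4 Phi],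
    has a coefficient which does depend on [r]: comparing it at two radii gives
    [M_4 Phi = 0], so that [Phi_3 = Phi_4 = 0] (lemma [lower_zero]).

    Every derivative of a parallel spinor therefore vanishes on the chart.
    The coordinate range is convex and a segment from any of its points to an
    interior point stays inside the chart after its starting point, so the
    mean value theorem together with continuity up to the boundary shows that
    the spinor is constant on the whole range.  Conversely the constants with
    [Phi_3 = Phi_4 = 0] are parallel, which gives dimension 2. *)

(** * Differentials of real-valued functions *)

Section Differentials.
Variables (R : realType) (V : normedModType R).
Implicit Types (p v : V) (f g df dg : V -> R).

Lemma is_diff_derive p v f df : is_diff p f df -> 'D_v f p = df v.
Proof. by move=> [df' <-]; rewrite deriveE. Qed.

Lemma is_diff_const p (c : R) : is_diff p (fun=> c) (fun=> 0).
Proof. exact: (is_diff_cst c p). Qed.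

Lemma is_diff_mul p f g df dg : is_diff p f df -> is_diff p g dg ->
  is_diff p (fun q => f q * g q) (fun v => f p * dg v + g p * df v).
Proof. by move=> ? ?; exact: (@is_diffM R V f g df dg p). Qed.

Lemma is_diff_add p f g df dg : is_diff p f df -> is_diff p g dg ->
  is_diff p (fun q => f q + g q) (fun v => df v + dg v).
Proof. by move=> ? ?; exact: (@is_diffD R V _ f g df dg p). Qed.

Lemma is_diff_opp p f df : is_diff p f df ->
  is_diff p (fun q => - f q) (fun v => - df v).
Proof. by move=> ?; exact: (@is_diffN R V _ f df p). Qed.

Lemma is_diff_sum p (I : Type) (s : seq I) (f df : I -> V -> R) :
  (forall i, is_diff p (f i) (df i)) ->
  is_diff p (fun q => \sum_(i <- s) f i q) (fun v => \sum_(i <- s) df i v).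
Proof.
move=> h; elim: s => [|i s IH].
  have -> : (fun q => \sum_(i <- [::]) f i q) = fun=> 0.
    by apply/funext => q; rewrite big_nil.
  have -> : (fun q => \sum_(i <- [::]) df i q) = fun=> 0.
    by apply/funext => q; rewrite big_nil.
  exact: is_diff_const.
under eq_fun do rewrite big_cons.
under [X in is_diff _ _ X]eq_fun do rewrite big_cons.
exact: is_diff_add.
Qed.

Lemma is_diff_scalar_comp p (g : R -> R) (dg : R) f df :
  is_diff p f df -> is_derive (f p) 1 g dg ->
  is_diff p (fun q => g (f q)) (fun v => dg * df v).
Proof.
move=> hf [hg hdg]; have hg' : is_diff (f p) g (fun h => dg * h).
  apply: DiffDef; first exact/derivable1_diffP.
  apply/funext => h.
  have -> : h = h *: (1 : R) by rewrite /GRing.scale /= mulr1.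
  rewrite linearZ /= -deriveE; last exact/derivable1_diffP.
  by rewrite hdg /GRing.scale /= mulr1 mulrC.
exact: (@is_diff_comp R V _ _ f df g _ p hf hg').
Qed.

Lemma is_diff_inv p f df : f p != 0 -> is_diff p f df ->
  is_diff p (fun q => (f q)^-1) (fun v => - f p ^- 2 * df v).
Proof.
move=> fp0 hf; have := @is_deriveV R id _ _ 1 fp0 (is_derive_id (f p) 1).
rewrite /GRing.scale /= mulr1; exact: is_diff_scalar_comp.
Qed.

End Differentials.

Lemma is_diff_coord (R : realType) n (p : 'rV[R]_n) i :
  is_diff p (fun q : 'rV[R]_n => q 0 i) (fun v : 'rV[R]_n => v 0 i).
Proof.
have d := @differentiable_coord R 1 n p 0 i.
apply: DiffDef => //; apply/funext => v.
pose f : 'rV[R]_n -> R := fun q => q 0 i.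
have lf : linear f by move=> a x y; rewrite /f !mxE.
pose lfL : {linear 'rV[R]_n -> R} :=
  HB.pack f (GRing.isLinear.Build R _ _ _ f lf).
by rewrite (@diff_lin _ _ _ lfL) //; exact: coord_continuous.
Qed.

(** The metric agrees with the Gram matrix of the coframe only where
    [1 - B / r^4] is positive, and a spinor is defined only on the coordinate
    range: differentiability has to be transported between functions that agree
    near a point. *)
Lemma near_eq_is_diff (R : numFieldType) (V W : normedModType R) (p : V) (f g df : V -> W) :
  (\near p, f p = g p) -> is_diff p f df -> is_diff p g df.
Proof.
move=> fg [/diff_locallyP [cdp /eqaddoP e] dfE].
have e' : g \o shift p = cst (g p) + 'd f p +o_ 0 id.
  apply/eqaddoP => eps eps0.
  have fg0 : \forall h \near 0, f (h + p) = g (h + p).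
    have := fg; rewrite (near_shift 0) subr0 => fg0.
    by near=> h; near: h.
  have := e eps eps0; apply: filterS2 fg0 => h fgh.
  suff -> : (g \o shift p - (cst (g p) + 'd f p)) h
            = (f \o shift p - (cst (f p) + 'd f p)) h by [].
  by rewrite !fctE /= fgh (nbhs_singleton fg).
have dg := diff_unique cdp e'.
apply: DiffDef; last by rewrite dg dfE.
apply/diff_locallyP; split; first by rewrite dg.
by rewrite dg.
Unshelve. all: by end_near. Qed.

(** * The Levi-Civita connection in an orthonormal frame *)

Section Koszul.
Variables (R : realType) (n : nat).
Implicit Types (G : 'rV[R]_n -> 'M[R]_n) (X Y Z p : 'rV[R]_n).

(** A one-form, as a row of components, evaluated on a vector. *)
Definition pairing (a X : 'rV[R]_n) : R := \sum_b a 0 b * X 0 b.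

Lemma innerE G p X Y : inner G p X Y = \sum_i \sum_j X 0 i * Y 0 j * G p i j.
Proof.
rewrite /inner mxE exchange_big /=; apply: eq_bigr => j _.
rewrite !mxE big_distrl /=; apply: eq_bigr => i _; ring.
Qed.

Lemma is_diff_derive_dir p (f : 'rV[R]_n -> R) X : differentiable f p ->
  'D_X f p = \sum_i X 0 i * partial f i p.
Proof.
move=> df; rewrite /partial deriveE //.
rewrite {1}(row_sum_delta X) linear_sum; apply: eq_bigr => i _.
by rewrite linearZ /= deriveE.
Qed.

Lemma derive_inner G p V X Y :
  (forall i j, differentiable (fun q => G q i j) p) ->
  'D_V (fun q => inner G q X Y) p
    = \sum_i \sum_j X 0 i * Y 0 j * 'D_V (fun q => G q i j) p.
Proof.
move=> dG; under eq_fun do rewrite innerE.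
have dG' i j : is_diff p (fun q => G q i j) ('d (fun q => G q i j) p).
  exact/differentiableP.
have dF i j := is_diff_mul (is_diff_const p (X 0 i * Y 0 j)) (dG' i j).
rewrite (is_diff_derive V (is_diff_sum _ (fun i => is_diff_sum _ (dF i)))).
apply: eq_bigr => i _; apply: eq_bigr => j _.
by rewrite mulr0 addr0 deriveE.
Qed.

(** With [X], [Y p] and [Z] frozen as constant fields, lowering the free index
    of the Christoffel symbols cancels the inverse of the metric, and the three
    derivatives of the metric entries assemble into directional derivatives of
    inner products. *)
Lemma koszul G (Y : 'rV[R]_n -> 'rV[R]_n) p X Z :
  (forall i j, differentiable (fun q => G q i j) p) ->
  (G p)^T = G p -> G p \in unitmx ->
  inner G p (levi_civita G X Y p) Z
  = inner G p (\row_k 'D_X (fun q => Y q 0 k) p) Z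
    + 2^-1 * ('D_X (fun q => inner G q (Y p) Z) p
              + 'D_(Y p) (fun q => inner G q X Z) p
              - 'D_Z (fun q => inner G q X (Y p)) p).
Proof.
move=> dG Gsym Gu.
pose S i j l := partial (fun q => G q j l) i p + partial (fun q => G q i l) j p
                - partial (fun q => G q i j) l p.
have -> : levi_civita G X Y p = \row_k 'D_X (fun q => Y q 0 k) p +
   (\row_l (2^-1 * \sum_i \sum_j X 0 i * Y p 0 j * S i j l)) *m invmx (G p).
  apply/rowP => k; rewrite !mxE; congr (_ + _).
  have Vsym a b : invmx (G p) a b = invmx (G p) b a.
    by rewrite -[in RHS]Gsym -trmx_inv mxE.
  under [RHS]eq_bigr => l _ do rewrite !mxE !big_distrr !big_distrl /=.
  rewrite [RHS]exchange_big /=; apply: eq_bigr => i _.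
  under [RHS]eq_bigr => l _ do rewrite !big_distrr !big_distrl /=.
  rewrite [RHS]exchange_big /=; apply: eq_bigr => j _.
  rewrite /christoffel big_distrr !big_distrl /=.
  by apply: eq_bigr => l _; rewrite Vsym -/(S i j l); ring.
rewrite /inner !mulmxDl mxE; congr (_ + _).
rewrite mulmxKV // mxE.
have e V W U : \sum_i \sum_j W 0 i * U 0 j * 'D_V (fun q => G q i j) p =
   \sum_i \sum_j \sum_l W 0 i * U 0 j * (V 0 l * partial (fun q => G q i j) l p).
  apply: eq_bigr => i _; apply: eq_bigr => j _.
  by rewrite is_diff_derive_dir // big_distrr.
(* The three derivatives sum over the indices of [X], [Y] and [Z] in different
   orders; [F] fixes the order [i], [j], [l] and leaves the derived entry
   [G a b] and the direction [c] as parameters. *)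
pose F i j l a b c := X 0 i * Y p 0 j * Z 0 l * partial (fun q => G q a b) c p.
have -> : 'D_X (fun q => inner G q (Y p) Z) p
    = \sum_i \sum_j \sum_l F i j l j l i.
  rewrite derive_inner // e; under eq_bigr => j _ do rewrite exchange_big /=.
  rewrite exchange_big /=; do 3![apply: eq_bigr => ? _]; rewrite /F; ring.
have -> : 'D_(Y p) (fun q => inner G q X Z) p
    = \sum_i \sum_j \sum_l F i j l i l j.
  rewrite derive_inner // e; apply: eq_bigr => i _; rewrite exchange_big /=.
  by do 2![apply: eq_bigr => ? _]; rewrite /F; ring.
have -> : 'D_Z (fun q => inner G q X (Y p)) p
    = \sum_i \sum_j \sum_l F i j l i j l.
  by rewrite derive_inner // e; do 3![apply: eq_bigr => ? _]; rewrite /F; ring.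
rewrite -big_split -sumrB big_distrr /=.
under eq_bigr => l _ do rewrite !mxE big_distrr big_distrl /=.
rewrite exchange_big; apply: eq_bigr => i _ /=.
rewrite -big_split -sumrB big_distrr /=.
under eq_bigr => l _ do rewrite big_distrr big_distrl /=.
rewrite exchange_big; apply: eq_bigr => j _ /=.
rewrite -big_split -sumrB big_distrr /=.
by apply: eq_bigr => l _; rewrite /F /S; ring.
Qed.

(** The exterior derivative [da(X, Y) = X(a(Y)) - Y(a(X))], where [X] and [Y]
    are extended as constant vector fields, so that the bracket term is zero. *)
Definition ext_deriv (a : 'rV[R]_n -> 'rV[R]_n) X Y p : R :=
  'D_X (fun q => pairing (a q) Y) p - 'D_Y (fun q => pairing (a q) X) p.

Lemma pairing_delta a i : pairing a (delta_mx 0 i) = a 0 i.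
Proof.
rewrite /pairing (bigD1 i) //= big1 ?addr0 => [|b /negPf bi].
  by rewrite mxE !eqxx mulr1.
by rewrite mxE bi andbF mulr0.
Qed.

(** Writing [A_m(V, Y)] for the derivative along [V] of [q |-> T_m(q)(Y)], the
    metric [sum_m T_m^2] turns every derivative of an inner product in
    [koszul] into a sum of terms [T_m(Y) A_m(V, Z)], and differentiating the
    duality [T_j(e_i) = delta_ij] replaces the derivative of the frame by
    [- A_j(X, e_i)].  What remains is antisymmetric in the arguments of each
    [A_m]. *)
Lemma connection_form G (T E : 'I_n -> 'rV[R]_n -> 'rV[R]_n) p X i j :
  (forall k Y, differentiable (fun q => pairing (T k q) Y) p) ->
  (forall k l, differentiable (fun q => E k q 0 l) p) ->
  (\forall q \near p, G q = \sum_k (T k q)^T *m T k q) ->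
  (\forall q \near p, forall k l, pairing (T k q) (E l q) = (k == l)%:R) ->
  inner G p (levi_civita G X (E i) p) (E j p)
  = 2^-1 * (ext_deriv (T i) X (E j p) p - ext_deriv (T j) X (E i p) p
            + \sum_m pairing (T m p) X * ext_deriv (T m) (E i p) (E j p) p).
Proof.
move=> dT dE nG nE.
have pE := nbhs_singleton nE; have pG := nbhs_singleton nG.
have dTe k l : differentiable (fun q => T k q 0 l) p.
  by have := dT k (delta_mx 0 l); under eq_fun do rewrite pairing_delta.
have diffT k Y := differentiableP (dT k Y).
have diffTe k l := differentiableP (dTe k l).
have diffE k l := differentiableP (dE k l).
pose A m V Y := 'D_V (fun q => pairing (T m q) Y) p.
have AE m V Y : A m V Y = \sum_b Y 0 b * 'D_V (fun q => T m q 0 b) p.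
  have dF b := is_diff_mul (diffTe m b) (is_diff_const p (Y 0 b)).
  rewrite /A (is_diff_derive V (is_diff_sum _ dF)).
  by apply: eq_bigr => b _; rewrite mulr0 add0r deriveE.
have Gentry q k l : G q = \sum_k (T k q)^T *m T k q ->
    G q k l = \sum_m T m q 0 k * T m q 0 l.
  by move=> ->; rewrite summxE; apply: eq_bigr => m _; rewrite mxE big_ord1 mxE.
have dG k l : differentiable (fun q => G q k l) p.
  have d := is_diff_sum (index_enum _)
    (fun m => is_diff_mul (diffTe m k) (diffTe m l)).
  suff /near_eq_is_diff/(_ d)[] : \forall q \near p,
    \sum_m T m q 0 k * T m q 0 l = G q k l by [].
  by apply: filterS nG => q /Gentry ->.
have innerT q Y Z : G q = \sum_k (T k q)^T *m T k q ->
    inner G q Y Z = \sum_m pairing (T m q) Y * pairing (T m q) Z.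
  move=> /Gentry Gq; rewrite innerE.
  under eq_bigr => k _ do under eq_bigr => l _ do rewrite Gq big_distrr /=.
  under eq_bigr => k _ do rewrite exchange_big /=.
  rewrite exchange_big /=; apply: eq_bigr => m _.
  rewrite /pairing big_distrl /=; apply: eq_bigr => k _.
  by rewrite big_distrr /=; apply: eq_bigr => l _; ring.
have DG V Y Z : 'D_V (fun q => inner G q Y Z) p = \sum_m
    (pairing (T m p) Y * A m V Z + pairing (T m p) Z * A m V Y).
  have dF m := is_diff_mul (diffT m Y) (diffT m Z).
  rewrite -[LHS](near_eq_derive (f := fun q =>
     \sum_m pairing (T m q) Y * pairing (T m q) Z)).
    rewrite (is_diff_derive V (is_diff_sum _ dF)).
    by apply: eq_bigr => m _; rewrite /A !deriveE.
  by apply: filterS nG => q /innerT ->.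
(* Duality makes the coframe matrix [M] invertible, hence the metric [M^T M]. *)
pose M := \matrix_(k, l) T k p 0 l; pose N := \matrix_(k, l) E k p 0 l.
have MN : M *m N^T = 1%:M.
  apply/matrixP => k l; rewrite !mxE -pE.
  by apply: eq_bigr => b _; rewrite !mxE.
have GM : G p = M^T *m M.
  apply/matrixP => k l; rewrite Gentry // mxE.
  by apply: eq_bigr => m _; rewrite !mxE.
have Gu : G p \in unitmx.
  by rewrite GM unitmx_mul unitmx_tr; case: (mulmx1_unit MN) => ->.
have Gs : (G p)^T = G p by rewrite GM trmx_mul trmxK.
have pick (F : 'I_n -> R) k : \sum_m (m == k)%:R * F m = F k.
  rewrite (bigD1 k) //= eqxx mul1r big1 ?addr0 // => m /negPf ->.
  by rewrite mul0r.
have DE : pairing (T j p) (\row_k 'D_X (fun q => E i q 0 k) p) = - A j X (E i p).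
  apply/eqP; rewrite -subr_eq0 opprK AE -big_split /=; apply/eqP.
  have dF b := is_diff_mul (diffTe j b) (diffE i b).
  have D0 : 'D_X (fun q => \sum_b T j q 0 b * E i q 0 b) p = 0.
    rewrite (near_eq_derive X (g := cst ((j == i)%:R : R))) ?derive_cst //.
    by apply: filterS nE => q /(_ j i).
  rewrite -[RHS]D0 (is_diff_derive X (is_diff_sum _ dF)).
  by apply: eq_bigr => b _; rewrite mxE !deriveE.
have pickE (F : 'I_n -> R) k : \sum_m pairing (T m p) (E k p) * F m = F k.
  by rewrite -[RHS]pick; apply: eq_bigr => m _; rewrite pE.
have DGE V k Y : 'D_V (fun q => inner G q (E k p) Y) p
    = A k V Y + \sum_m pairing (T m p) Y * A m V (E k p).
  by rewrite DG big_split /= pickE.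
have innerC V Y Z : 'D_V (fun q => inner G q Y Z) p
    = 'D_V (fun q => inner G q Z Y) p.
  by rewrite !DG; apply: eq_bigr => m _; rewrite addrC.
have innerE' Y : inner G p Y (E j p) = pairing (T j p) Y.
  by rewrite innerT //; under eq_bigr => m _ do rewrite mulrC; rewrite pickE.
rewrite koszul // innerE' DE (innerC _ X (E j p)) (innerC _ X) !DGE pickE.
have EA m Y Z : ext_deriv (T m) Y Z p = A m Y Z - A m Z Y by [].
rewrite !EA; under [X in _ = _ * (_ + X)]eq_bigr => m _ do rewrite EA mulrBr.
by rewrite sumrB; clearbody A; field.
Qed.

End Koszul.

(** * The coframe and its dual frame *)

Lemma inord4E : (inord 0 = @Ordinal 4 0 isT) * (inord 1 = @Ordinal 4 1 isT)
  * (inord 2 = @Ordinal 4 2 isT) * (inord 3 = @Ordinal 4 3 isT).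
Proof. by do !split; apply/val_inj; rewrite /= inordK. Qed.

Lemma sum4E (V : nmodType) (F : 'I_4 -> V) :
  \sum_i F i = F (inord 0) + F (inord 1) + F (inord 2) + F (inord 3).
Proof.
rewrite !big_ord_recr big_ord0 /= add0r !inord4E.
by congr (F _ + F _ + F _ + F _); apply/val_inj.
Qed.

Lemma ord4_all (P : 'I_4 -> Prop) :
  P (inord 0) -> P (inord 1) -> P (inord 2) -> P (inord 3) -> forall k, P k.
Proof.
rewrite !inord4E => P0 P1 P2 P3 [[|[|[|[|k]]]] lk] //;
by rewrite (bool_irrelevance lk isT).
Qed.

Lemma ord2_all (P : 'I_2 -> Prop) : P 0 -> P 1 -> forall k, P k.
Proof.
by move=> P0 P1 [[|[|k]] lk] //; [move: P0|move: P1];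
  congr P; apply/val_inj.
Qed.

Lemma inord4K : ((inord 0 : 'I_4) = 0%N :> nat) * ((inord 1 : 'I_4) = 1%N :> nat)
  * ((inord 2 : 'I_4) = 2%N :> nat) * ((inord 3 : 'I_4) = 3%N :> nat).
Proof. by rewrite !inordK. Qed.

Section EguchiHansonGeometry.
Variables (R : realType) (B : R).
Hypothesis B_gt0 : 0 < B.
Implicit Types (p q X Y : 'rV[R]_4).
Local Notation f := (eh_f B).

Lemma chart_rcoord p : eh_chart B p -> 0 < rcoord p /\ B < rcoord p ^+ 4.
Proof.
case=> hr _ _ _; have r0 : 0 < rcoord p by exact: lt_trans (powR_gt0 _ B_gt0) hr.
split=> //; have : (B `^ 4^-1) `^ 4 < rcoord p `^ 4.
  by apply: gt0_ltr_powR; rewrite ?nnegrE ?powR_ge0 // ltW.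
by rewrite -powRrM mulVf // powRr1 ?ltW // powR_mulrn // ltW.
Qed.

Lemma eh_f_gt0 (r : R) : 0 < r -> B < r ^+ 4 -> 0 < f r.
Proof. by move=> r0 Br; rewrite sqrtr_gt0 subr_gt0 ltr_pdivrMr ?mul1r ?exprn_gt0. Qed.

Lemma eh_f_sqr (r : R) : 0 < r -> B < r ^+ 4 -> f r ^+ 2 = 1 - B / r ^+ 4.
Proof.
move=> r0 Br; rewrite sqr_sqrtr // subr_ge0 ltW //.
by rewrite ltr_pdivrMr ?mul1r ?exprn_gt0.
Qed.

Lemma is_derive_eh_f (r : R) : 0 < r -> B < r ^+ 4 ->
  is_derive r 1 f (2 * B / (r ^+ 5 * f r)).
Proof.
move=> r0 Br; have f0 := eh_f_gt0 r0 Br.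
have dg : is_derive r 1 (fun s : R => 1 - B * (s ^+ 4)^-1) (4 * B / r ^+ 5).
  have r40 : r ^+ 4 != 0 by rewrite gt_eqF ?exprn_gt0.
  have dX : is_derive r 1 (fun s : R => s ^+ 4) (4%:R * r ^+ 3).
    rewrite -[fun s => _]/(fun s => id s ^+ 4) -exprfctE.
    apply: (is_derive_eq (is_deriveX 4 (is_derive_id r 1))).
    by rewrite /GRing.scale /= mulr1.
  have dV := @is_deriveV R (fun s => s ^+ 4) r _ 1 r40 dX.
  have h := is_deriveB (is_derive_cst (1 : R) r 1) (is_deriveZ B dV).
  refine (is_derive_eq (h : is_derive r 1 (fun s : R => 1 - B * (s ^+ 4)^-1) _) _).
  by rewrite /GRing.scale /=; field; rewrite gt_eqF.
have g0 : 0 < 1 - B * (r ^+ 4)^-1.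
  by rewrite subr_gt0 ltr_pdivrMr ?mul1r ?exprn_gt0.
have h : is_derive r 1 f _ :=
  @is_derive1_comp R Num.sqrt (fun s => 1 - B * (s ^+ 4)^-1) r _ _
    (is_derive1_sqrt g0) dg.
apply: (is_derive_eq h).
by rewrite -/(f r); field; rewrite !gt_eqF.
Qed.

Lemma open_chart : open (eh_chart B).
Proof.
rewrite openE => p [pr /andP[pt pt'] /andP[pf pf'] /andP[ps ps']].
have c i : (fun q : 'rV[R]_4 => q 0 i) @ p --> p 0 i by exact: coord_continuous.
rewrite /interior /=; near=> q; split.
- by near: q; exact: cvgr_gt (c _) _ pr.
- by apply/andP; split; near: q;
    [exact: cvgr_gt (c _) _ pt | exact: cvgr_lt (c _) _ pt'].
- by apply/andP; split; near: q;
    [exact: cvgr_gt (c _) _ pf | exact: cvgr_lt (c _) _ pf'].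
- by apply/andP; split; near: q;
    [exact: cvgr_gt (c _) _ ps | exact: cvgr_lt (c _) _ ps'].
Unshelve. all: by end_near. Qed.

Lemma near_chart p : eh_chart B p -> \forall q \near p, eh_chart B q.
Proof. by move=> pc; apply: open_nbhs_nbhs; split=> //; exact: open_chart. Qed.

Definition eh_coframe (k : 'I_4) p : 'rV[R]_4 :=
  let: r := rcoord p in
  nth 0 [:: (f r)^-1 *: row4 1 0 0 0; r *: sigma1 p; r *: sigma2 p;
            (r * f r) *: sigma3 p] k.

Lemma pairing_row4 (a b c d : R) X : pairing (row4 a b c d) X
  = a * rcoord X + b * theta X + c * phi X + d * psi X.
Proof. by rewrite /pairing sum4E !mxE !inordK. Qed.

Lemma pairingZl (c : R) (a X : 'rV[R]_4) : pairing (c *: a) X = c * pairing a X.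
Proof. by rewrite /pairing big_distrr /=; apply: eq_bigr => b _; rewrite mxE mulrA. Qed.

Lemma sqformZ (c : R) (a : 'rV[R]_4) : sqform (c *: a) = c ^+ 2 *: sqform a.
Proof. by rewrite /sqform linearZ /= linearZ /= -scalemxAl scalerA. Qed.

Lemma eh_metricE p : eh_chart B p ->
  eh_metric B p = \sum_k (eh_coframe k p)^T *m eh_coframe k p.
Proof.
move=> /chart_rcoord [r0 Br]; rewrite sum4E /eh_coframe !inordK //=.
rewrite -!/(sqform _) /eh_metric -eh_f_sqr // /sigma1 /sigma2 /sigma3 !sqformZ.
by rewrite !scalerDr !scalerA !addrA !exprVn exprMn !mulrA.
Qed.

Lemma rcoord_row4 a b c d : rcoord (row4 a b c d : 'rV[R]_4) = a.
Proof. by rewrite /rcoord mxE inordK. Qed.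
Lemma theta_row4 a b c d : theta (row4 a b c d : 'rV[R]_4) = b.
Proof. by rewrite /theta mxE inordK. Qed.
Lemma phi_row4 a b c d : phi (row4 a b c d : 'rV[R]_4) = c.
Proof. by rewrite /phi mxE inordK. Qed.
Lemma psi_row4 a b c d : psi (row4 a b c d : 'rV[R]_4) = d.
Proof. by rewrite /psi mxE inordK. Qed.
Definition coord_row4 := (rcoord_row4, theta_row4, phi_row4, psi_row4).

Lemma pairingZr (c : R) (a X : 'rV[R]_4) : pairing a (c *: X) = c * pairing a X.
Proof. by rewrite /pairing big_distrr /=; apply: eq_bigr => b _; rewrite mxE mulrCA. Qed.

Lemma eh_frame_dual p k l : eh_chart B p ->
  pairing (eh_coframe k p) (eh_frame B l p) = (k == l)%:R.
Proof.
move=> pc; have [r0 Br] := chart_rcoord pc; have f0 := eh_f_gt0 r0 Br.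
have st0 : 0 < sin (theta p).
  by case: pc => _ /andP[t0 tpi] _ _; apply: sin_gt0_pi; rewrite t0.
have Es := cos2Dsin2 (psi p).
rewrite /eh_coframe /eh_frame /sigma1 /sigma2 /sigma3.
move: k l; apply: ord4_all; apply: ord4_all; rewrite -val_eqE /= !inordK //=;
rewrite !(pairingZl, pairingZr) pairing_row4 !coord_row4.
all: try by field; rewrite ?gt_eqF.
all: rewrite -[RHS]Es; field; rewrite ?gt_eqF //.
Qed.

End EguchiHansonGeometry.

(** * Structure equations and the connection *)

Section StructureEquations.
Variables (R : realType) (B : R).
Hypothesis B_gt0 : 0 < B.
Implicit Types (p q X Y : 'rV[R]_4).
Local Notation f := (eh_f B).

(** The derivative [2 B / (r^5 f)] of [f], with [B] eliminated through
    [B = (1 - f^2) r^4]: every later identity then becomes rational in [r]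
    and [f]. *)
Definition eh_df (r : R) : R := 2 * (1 - f r ^+ 2) / (r * f r).

Lemma is_diff_f p : eh_chart B p ->
  is_diff p (fun q => f (rcoord q)) (fun v => eh_df (rcoord p) * rcoord v).
Proof.
move=> /(chart_rcoord B_gt0) [r0 Br].
apply: (is_diff_scalar_comp (is_diff_coord p (inord 0))).
apply: (is_derive_eq (is_derive_eh_f r0 Br)).
have f0 := eh_f_gt0 r0 Br.
by rewrite /eh_df eh_f_sqr //; field; rewrite !gt_eqF.
Qed.

Lemma is_diff_inv_f p : eh_chart B p ->
  is_diff p (fun q => (f (rcoord q))^-1)
    (fun v => - (f (rcoord p) ^- 2 * eh_df (rcoord p)) * rcoord v).
Proof.
move=> pc; have [r0 Br] := chart_rcoord B_gt0 pc.
have f0 := eh_f_gt0 r0 Br.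
have f0' : f (rcoord p) != 0 by rewrite gt_eqF.
refine (is_diff_eq (is_diff_inv (f := fun q => f (rcoord q)) f0' (is_diff_f pc)) _).
by apply/funext => v; ring.
Qed.

Lemma is_diff_sin p i :
  is_diff p (fun q : 'rV[R]_4 => sin (q 0 i)) (fun v => cos (p 0 i) * v 0 i).
Proof. exact: (is_diff_scalar_comp (is_diff_coord p i) (is_derive_sin _)). Qed.

Lemma is_diff_cos p i :
  is_diff p (fun q : 'rV[R]_4 => cos (q 0 i)) (fun v => - sin (p 0 i) * v 0 i).
Proof. exact: (is_diff_scalar_comp (is_diff_coord p i) (is_derive_cos _)). Qed.

Lemma pairing_coframe p X :
  [/\ pairing (eh_coframe B (inord 0) p) X = (f (rcoord p))^-1 * rcoord X,
   pairing (eh_coframe B (inord 1) p) X = rcoord p *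
     (2^-1 * (sin (psi p) * theta X - sin (theta p) * cos (psi p) * phi X)),
   pairing (eh_coframe B (inord 2) p) X = rcoord p *
     (2^-1 * (- cos (psi p) * theta X - sin (theta p) * sin (psi p) * phi X)) &
   pairing (eh_coframe B (inord 3) p) X = rcoord p * f (rcoord p) *
     (2^-1 * (cos (theta p) * phi X + psi X))].
Proof.
rewrite /eh_coframe /sigma1 /sigma2 /sigma3 !inordK //=.
by rewrite !pairingZl !pairing_row4; split; ring.
Qed.

Ltac solve_is_diff :=
  repeat first
    [ apply: is_diff_const | apply: is_diff_sin | apply: is_diff_cos
    | apply: is_diff_coord | by apply: is_diff_f | by apply: is_diff_inv_f
    | apply: is_diff_mul | apply: is_diff_add | apply: is_diff_opp ].

Lemma is_diff_coframe p X : eh_chart B p ->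
  [/\ is_diff p (fun q => pairing (eh_coframe B (inord 0) q) X)
       (fun v => - (f (rcoord p) ^- 2 * eh_df (rcoord p)) * rcoord v * rcoord X),
   is_diff p (fun q => pairing (eh_coframe B (inord 1) q) X) (fun v =>
     2^-1 * (rcoord v *
         (sin (psi p) * theta X - sin (theta p) * cos (psi p) * phi X)
       + rcoord p * (cos (psi p) * psi v * theta X
          - (cos (theta p) * theta v * cos (psi p)
             - sin (theta p) * sin (psi p) * psi v) * phi X))),
   is_diff p (fun q => pairing (eh_coframe B (inord 2) q) X) (fun v =>
     2^-1 * (rcoord v *
         (- cos (psi p) * theta X - sin (theta p) * sin (psi p) * phi X)
       + rcoord p * (sin (psi p) * psi v * theta X
          - (cos (theta p) * theta v * sin (psi p)
             + sin (theta p) * cos (psi p) * psi v) * phi X))) &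
   is_diff p (fun q => pairing (eh_coframe B (inord 3) q) X) (fun v =>
     2^-1 * ((f (rcoord p) + rcoord p * eh_df (rcoord p)) * rcoord v
                * (cos (theta p) * phi X + psi X)
       - rcoord p * f (rcoord p) * sin (theta p) * theta v * phi X))].
Proof.
move=> pc; have z v : (0 : 'rV[R]_4 -> R) v = 0 by [].
split.
- under eq_fun => q do have [-> _ _ _] := pairing_coframe q X.
  eapply is_diff_eq; first by solve_is_diff.
  by apply/funext => v; rewrite /rcoord ?z; ring.
- under eq_fun => q do have [_ -> _ _] := pairing_coframe q X.
  eapply is_diff_eq; first by solve_is_diff.
  by apply/funext => v; rewrite /rcoord /theta /phi /psi ?z; ring.
- under eq_fun => q do have [_ _ -> _] := pairing_coframe q X.
  eapply is_diff_eq; first by solve_is_diff.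
  by apply/funext => v; rewrite /rcoord /theta /phi /psi ?z; ring.
- under eq_fun => q do have [_ _ _ ->] := pairing_coframe q X.
  eapply is_diff_eq; first by solve_is_diff.
  by apply/funext => v; rewrite /rcoord /theta /phi /psi ?z; ring.
Qed.

(** [t k] is the coframe, so [w k l] is [T_k /\ T_l] evaluated on [X] and [Y].
    The terms with [T_0] come from differentiating [r] and [r f]; the others
    are the Maurer-Cartan equations of the [sigma_i]. *)
Lemma structure_equations p X Y : eh_chart B p ->
  let r := rcoord p in
  let t k Z := pairing (eh_coframe B (inord k) p) Z in
  let w k l := t k X * t l Y - t k Y * t l X in
  [/\ ext_deriv (eh_coframe B (inord 0)) X Y p = 0,
   ext_deriv (eh_coframe B (inord 1)) X Y p
     = f r / r * w 0%N 1%N + 2 / (r * f r) * w 2%N 3%N,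
   ext_deriv (eh_coframe B (inord 2)) X Y p
     = f r / r * w 0%N 2%N + 2 / (r * f r) * w 3%N 1%N &
   ext_deriv (eh_coframe B (inord 3)) X Y p
     = (2 - f r ^+ 2) / (r * f r) * w 0%N 3%N + 2 * f r / r * w 1%N 2%N].
Proof.
move=> pc r t w; have [r0 Br] := chart_rcoord B_gt0 pc.
have f0 := eh_f_gt0 r0 Br; rewrite /w /t /r /ext_deriv.
have [x0 x1 x2 x3] := pairing_coframe p X.
have [y0 y1 y2 y3] := pairing_coframe p Y.
have [dx0 dx1 dx2 dx3] := is_diff_coframe X pc.
have [dy0 dy1 dy2 dy3] := is_diff_coframe Y pc.
rewrite x0 x1 x2 x3 y0 y1 y2 y3.
rewrite (is_diff_derive _ dx0) (is_diff_derive _ dx1) (is_diff_derive _ dx2).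
rewrite (is_diff_derive _ dx3) (is_diff_derive _ dy0) (is_diff_derive _ dy1).
rewrite (is_diff_derive _ dy2) (is_diff_derive _ dy3) /eh_df.
have Es := cos2Dsin2 (psi p).
split; first ring.
- by field; rewrite !gt_eqF.
- by field; rewrite !gt_eqF.
(* The sine of theta must be multiplied by [cos^2 psi + sin^2 psi] to match
   the product of sigma_1 and sigma_2; the difference is isolated here. *)
apply/eqP; rewrite -subr_eq0; apply/eqP.
transitivity (2^-1 * rcoord p * f (rcoord p) * sin (theta p)
  * (theta X * phi Y - theta Y * phi X)
  * (cos (psi p) ^+ 2 + sin (psi p) ^+ 2 - 1)).
  by field; rewrite !gt_eqF.
by rewrite Es subrr mulr0.
Qed.

Lemma eh_frame_differentiable p k l : eh_chart B p ->
  differentiable (fun q => eh_frame B k q 0 l) p.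
Proof.
move=> pc; have [r0 Br] := chart_rcoord B_gt0 pc.
have f0 := eh_f_gt0 r0 Br.
have st0 : 0 < sin (theta p).
  by case: pc => _ /andP[t0 tpi] _ _; apply: sin_gt0_pi; rewrite t0.
suff [df []] : exists df, is_diff p (fun q => eh_frame B k q 0 l) df by [].
have dinv_r := is_diff_inv (f := fun q => rcoord q) (lt0r_neq0 r0)
  (is_diff_coord p (inord 0)).
have dinv_rf := is_diff_inv (f := fun q => rcoord q * f (rcoord q))
  (lt0r_neq0 (mulr_gt0 r0 f0))
  (is_diff_mul (is_diff_coord p (inord 0)) (is_diff_f pc)).
have dinv_st := is_diff_inv (f := fun q => sin (theta q)) (lt0r_neq0 st0)
  (is_diff_sin p (inord 1)).
rewrite /eh_frame.
move: k l; apply: ord4_all; apply: ord4_all; rewrite !inordK //=; eexists.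
all: under eq_fun do rewrite !mxE !inordK //=; rewrite /rcoord /theta /psi;
  repeat first [exact: dinv_r | exact: dinv_rf | exact: dinv_st
                | progress solve_is_diff].
Qed.

(** The antisymmetric 4 x 4 matrices with [w_01 = - w_23], [w_02 = - w_31] and
    [w_03 = - w_12]. *)
Definition anti_self_dual (a b c : R) (i j : 'I_4) : R :=
  nth 0 (nth [::] [:: [:: 0; a; b; c]; [:: - a; 0; - c; b];
                      [:: - b; c; 0; - a]; [:: - c; - b; a; 0]] i) j.

(** The three parameters are [f sigma_1], [f sigma_2] and
    [(2 - f^2) sigma_3].  The last one occurs twice, as [w_03] from
    [f / r + f'] and as [- w_12] from [2 / (r f) - f / r]; their equality is the
    anti-self-duality special to this metric. *)
Lemma eh_connectionE p X i j : eh_chart B p ->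
  inner (eh_metric B) p (levi_civita (eh_metric B) X (eh_frame B i) p)
    (eh_frame B j p)
  = let r := rcoord p in let t k := pairing (eh_coframe B (inord k) p) X in
    anti_self_dual (f r / r * t 1%N) (f r / r * t 2%N)
      ((2 - f r ^+ 2) / (r * f r) * t 3%N) i j.
Proof.
move=> pc; have [r0 Br] := chart_rcoord B_gt0 pc.
have f0 := eh_f_gt0 r0 Br.
rewrite (connection_form (T := eh_coframe B)); last 4 first.
- move=> k Y; have := is_diff_coframe Y pc.
  by move: k; apply: ord4_all => -[] [].
- by move=> k l; exact: eh_frame_differentiable.
- by apply: filterS (near_chart pc) => q; exact: eh_metricE.
- by apply: filterS (near_chart pc) => q qc k l; exact: eh_frame_dual.
rewrite sum4E /anti_self_dual /=.
have D k l : pairing (eh_coframe B k p) (eh_frame B l p) = (k == l)%:R.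
  exact: eh_frame_dual.
have S0 Y Z := let: And4 h _ _ _ := structure_equations Y Z pc in h.
have S1 Y Z := let: And4 _ h _ _ := structure_equations Y Z pc in h.
have S2 Y Z := let: And4 _ _ h _ := structure_equations Y Z pc in h.
have S3 Y Z := let: And4 _ _ _ h := structure_equations Y Z pc in h.
move: i j; apply: ord4_all; apply: ord4_all; rewrite ?inordK //=;
  rewrite !(S0, S1, S2, S3) !D -!val_eqE /= !inordK //=.
all: by field; rewrite !gt_eqF.
Qed.

End StructureEquations.

(** * Clifford multiplication by an anti-self-dual two-form *)

Section AntiSelfDualCombination.
Variables (K : comNzRingType).

(** The left-hand side is the expanded sum of an anti-self-dual coefficient
    matrix against [F i j]: each parameter collects one antisymmetrized pair
    containing the index 0, minus that of the two complementary indices. *)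
Lemma anti_self_dual_combination m (a b c : K)
    (F : nat -> nat -> 'M[K]_m) :
  0 *: F 0%N 0%N + a *: F 0%N 1%N + b *: F 0%N 2%N + c *: F 0%N 3%N
  + (- a *: F 1%N 0%N + 0 *: F 1%N 1%N + - c *: F 1%N 2%N + b *: F 1%N 3%N)
  + (- b *: F 2%N 0%N + c *: F 2%N 1%N + 0 *: F 2%N 2%N + - a *: F 2%N 3%N)
  + (- c *: F 3%N 0%N + - b *: F 3%N 1%N + a *: F 3%N 2%N + 0 *: F 3%N 3%N)
  = a *: (F 0%N 1%N - F 1%N 0%N - (F 2%N 3%N - F 3%N 2%N))
    + b *: (F 0%N 2%N - F 2%N 0%N - (F 3%N 1%N - F 1%N 3%N))
    + c *: (F 0%N 3%N - F 3%N 0%N - (F 1%N 2%N - F 2%N 1%N)).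
Proof. by apply/matrixP => i j; rewrite !mxE; ring. Qed.

(** Each commutator [G_0 G_k - G_k G_0] is [2 A_k] on the upper block and
    [- 2 A_k] on the lower one, whereas by the quaternion relations the
    commutator of the complementary pair is [2 A_k] on both blocks.  An
    anti-self-dual combination subtracts the two, which cancels the upper
    block and doubles the lower one. *)
Lemma clifford_asd_combination n (a b c : K) (I J L : 'M[K]_n)
    (G : nat -> 'M[K]_(n + n)) :
  I *m J = L -> J *m I = - L -> J *m L = I -> L *m J = - I ->
  L *m I = J -> I *m L = - J ->
  G 0%N = block_mx 0 1%:M (- 1%:M) 0 -> G 1%N = block_mx 0 I I 0 ->
  G 2%N = block_mx 0 J J 0 -> G 3%N = block_mx 0 L L 0 ->
  let F i j := G i *m G j in
  a *: (F 0%N 1%N - F 1%N 0%N - (F 2%N 3%N - F 3%N 2%N))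
  + b *: (F 0%N 2%N - F 2%N 0%N - (F 3%N 1%N - F 1%N 3%N))
  + c *: (F 0%N 3%N - F 3%N 0%N - (F 1%N 2%N - F 2%N 1%N))
  = (- 4) *: block_mx 0 0 0 (a *: I + b *: J + c *: L).
Proof.
move=> IJ JI JL LJ LI IL G0E G1E G2E G3E F; rewrite /F.
have GE k A : G k = block_mx 0 A A 0 ->
    G 0%N *m G k - G k *m G 0%N = block_mx (2 *: A) 0 0 ((- 2) *: A).
  move=> ->; rewrite G0E !mulmx_block.
  rewrite !(mul0mx, mulmx0, mul1mx, mulmx1, mulNmx, mulmxN, addr0, add0r).
  rewrite opp_block_mx add_block_mx !opprK !oppr0 !addr0.
  by rewrite scaleNr !scaler_nat !mulr2n opprD.
have GGE k l A A' A'' : G k = block_mx 0 A A 0 -> G l = block_mx 0 A' A' 0 ->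
    A *m A' = A'' -> A' *m A = - A'' ->
    G k *m G l - G l *m G k = block_mx (2 *: A'') 0 0 (2 *: A'').
  move=> -> -> e e'; rewrite !mulmx_block.
  rewrite !(mul0mx, mulmx0, addr0, add0r) e e'.
  rewrite opp_block_mx add_block_mx !opprK !oppr0 !addr0.
  by rewrite !scaler_nat !mulr2n.
rewrite (GE _ _ G1E) (GE _ _ G2E) (GE _ _ G3E).
rewrite (GGE _ _ _ _ _ G2E G3E JL LJ) (GGE _ _ _ _ _ G3E G1E LI IL).
rewrite (GGE _ _ _ _ _ G1E G2E IJ JI).
have blk (A : 'M[K]_n) : block_mx (2 *: A) 0 0 ((- 2) *: A)
    - block_mx (2 *: A) 0 0 (2 *: A) = (- 4) *: block_mx 0 0 0 A.
  rewrite opp_block_mx add_block_mx scale_block_mx !scaler0 !subrr -scalerBl.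
  by rewrite -opprD -natrD.
rewrite !blk !scale_block_mx !add_block_mx !scaler0 !addr0.
by rewrite !scalerDr !scalerA !(mulrC (- 4)).
Qed.

End AntiSelfDualCombination.

Section CliffordAlgebra.
Variable R : realType.
Local Notation C := R[i].

Lemma cM23 : cM2 R *m cM3 R = cM4 R.
Proof.
apply/matrixP; apply: ord2_all; apply: ord2_all;
  rewrite !mxE !big_ord_recl big_ord0 !mxE /=; ring.
Qed.

Lemma cM32 : cM3 R *m cM2 R = - cM4 R.
Proof.
apply/matrixP; apply: ord2_all; apply: ord2_all;
  rewrite !mxE !big_ord_recl big_ord0 !mxE /=; ring.
Qed.

Lemma cM34 : cM3 R *m cM4 R = cM2 R.
Proof.
apply/matrixP; apply: ord2_all; apply: ord2_all;
  rewrite !mxE !big_ord_recl big_ord0 !mxE /=; ring.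
Qed.

Lemma cM43 : cM4 R *m cM3 R = - cM2 R.
Proof.
apply/matrixP; apply: ord2_all; apply: ord2_all;
  rewrite !mxE !big_ord_recl big_ord0 !mxE /=; ring.
Qed.

Lemma cM42 : cM4 R *m cM2 R = cM3 R.
Proof.
apply/matrixP; apply: ord2_all; apply: ord2_all;
  rewrite !mxE !big_ord_recl big_ord0 !mxE /=; ring: (sqrCi C).
Qed.

Lemma cM24 : cM2 R *m cM4 R = - cM3 R.
Proof.
apply/matrixP; apply: ord2_all; apply: ord2_all;
  rewrite !mxE !big_ord_recl big_ord0 !mxE /=; ring: (sqrCi C).
Qed.

Definition asd_endo (a b c : R) : 'M[C]_2 :=
  a%:C%C *: cM2 R + b%:C%C *: cM3 R + c%:C%C *: cM4 R.

Lemma sum_anti_self_dual m (a b c : R) (F : nat -> nat -> 'M[C]_m) :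
  \sum_(i < 4) \sum_(j < 4) (anti_self_dual a b c i j)%:C%C *: F i j
  = a%:C%C *: (F 0%N 1%N - F 1%N 0%N - (F 2%N 3%N - F 3%N 2%N))
    + b%:C%C *: (F 0%N 2%N - F 2%N 0%N - (F 3%N 1%N - F 1%N 3%N))
    + c%:C%C *: (F 0%N 3%N - F 3%N 0%N - (F 1%N 2%N - F 2%N 1%N)).
Proof.
rewrite !sum4E /anti_self_dual !inord4K /= !rmorphN !rmorph0.
rewrite -anti_self_dual_combination.
reflexivity.
Qed.

Lemma clifford_asd (a b c : R) :
  let G k : 'M[C]_(2 + 2) := clifford R (inord k) in
  \sum_(i < 4) \sum_(j < 4)
    (anti_self_dual a b c i j)%:C%C *: (G i *m G j)
  = (- 4) *: block_mx 0 0 0 (asd_endo a b c).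
Proof.
move=> G; rewrite (sum_anti_self_dual a b c (fun i j => G i *m G j)).
by apply: clifford_asd_combination;
  rewrite ?(cM23, cM32, cM34, cM43, cM24, cM42) // /G /clifford inord4K.
Qed.

End CliffordAlgebra.

(** * The spin connection in blocks *)

Section SpinConnection.
Variables (R : realType) (B : R).
Hypothesis B_gt0 : 0 < B.
Local Notation C := R[i].
Implicit Types (Phi : spinor B) (p q X : 'rV[R]_4).
Local Notation f := (eh_f B).

(** The endomorphism [f sigma_1 M_2 + f sigma_2 M_3 + (2 - f^2) sigma_3 M_4]
    evaluated on [X]. *)
Definition spin_form p X : 'M[C]_2 :=
  let t k := pairing (eh_coframe B (inord k) p) X in
  let r := rcoord p in
  asd_endo (f r / r * t 1%N) (f r / r * t 2%N)
    ((2 - f r ^+ 2) / (r * f r) * t 3%N).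

(** The factor 1/4 of the spin connection cancels the factor - 4 of
    [clifford_asd], which leaves minus the block matrix acting on the last two
    components. *)
Lemma spin_connectionE X Phi p : eh_chart B p ->
  let Psi : 'cV[C]_(2 + 2) := 'valL_(0 : 'cV[C]_4) Phi p in
  spin_connection X Phi p
  = spinor_deriv X Phi p - (col_mx 0 (spin_form p X *m dsubmx Psi) : 'cV_(2 + 2)).
Proof.
move=> pc Psi; rewrite /spin_connection; congr (_ + _).
under eq_bigr => i _ do under eq_bigr => j _ do
  rewrite (eh_connectionE B_gt0) // scalemxAl.
under eq_bigr => i _ do rewrite -mulmx_suml.
rewrite -mulmx_suml.
have := clifford_asd (f (rcoord p) / rcoord p * pairing (eh_coframe B (inord 1) p) X)
  (f (rcoord p) / rcoord p * pairing (eh_coframe B (inord 2) p) X)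
  ((2 - f (rcoord p) ^+ 2) / (rcoord p * f (rcoord p)) * pairing (eh_coframe B (inord 3) p) X).
move=> /=; under eq_bigr => i _ do under eq_bigr => j _ do rewrite !inord_val.
move=> h; rewrite [X in X *m _](h : _ = _ :> 'M[C]_4).
rewrite -scalemxAl scalerA mulrN mulVf ?pnatr_eq0 // scaleN1r; congr (- _).
have blk (N : 'M[C]_2) : (block_mx 0 0 0 N : 'M[C]_(2 + 2)) *m Psi
    = col_mx 0 (N *m dsubmx Psi).
  by rewrite -{1}[Psi]vsubmxK mul_block_col !mul0mx !add0r.
exact: blk.
Qed.

Lemma spin_connection_upper X Phi p (k : 'I_2) : eh_chart B p ->
  spin_connection X Phi p (lshift 2 k) 0 = spinor_deriv X Phi p (lshift 2 k) 0.
Proof.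
move=> pc; rewrite spin_connectionE // mxE [X in _ + X]mxE.
have -> (D : 'cV[C]_2) : (col_mx 0 D : 'cV_(2 + 2)) (lshift 2 k) 0 = 0.
  by rewrite col_mxEu mxE.
by rewrite subr0.
Qed.

Lemma spin_connection_lower X Phi p (k : 'I_2) : eh_chart B p ->
  spin_connection X Phi p (rshift 2 k) 0 = spinor_deriv X Phi p (rshift 2 k) 0
   - \sum_l spin_form p X k l * 'valL_(0 : 'cV[C]_4) Phi p (rshift 2 l) 0.
Proof.
move=> pc; rewrite spin_connectionE // mxE [X in _ + X]mxE; congr (_ - _).
have -> (D : 'cV[C]_2) : (col_mx 0 D : 'cV_(2 + 2)) (rshift 2 k) 0 = D k 0.
  by rewrite col_mxEd.
by rewrite mxE; apply: eq_bigr => l _; rewrite [dsubmx _ _ _]mxE.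
Qed.

(** The radial direction is orthogonal to the [sigma_i], so the equation in
    that direction has no zeroth-order term. *)
Lemma spin_form_radial p (h : R) : spin_form p (row4 h 0 0 0) = 0.
Proof.
rewrite /spin_form.
have [_ -> -> ->] := pairing_coframe B p (row4 h 0 0 0).
rewrite !coord_row4 !(mulr0, subr0, addr0) /asd_endo.
by rewrite rmorph0 !scale0r !addr0.
Qed.

Lemma spin_form_psi p : eh_chart B p ->
  spin_form p (row4 0 0 0 1) = ((2 - f (rcoord p) ^+ 2) / 2)%:C%C *: cM4 R.
Proof.
move=> pc; have [r0 Br] := chart_rcoord B_gt0 pc; have f0 := eh_f_gt0 r0 Br.
rewrite /spin_form.
have [_ -> -> ->] := pairing_coframe B p (row4 0 0 0 1).
rewrite !coord_row4 !(mulr0, subr0, add0r, mulr1, oppr0) /asd_endo rmorph0.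
rewrite !scale0r !add0r.
by congr (_%:C%C *: _); field; rewrite !gt_eqF.
Qed.

Lemma spinor_derivE X Phi p a : spinor_deriv X Phi p a 0
  = ('D_X (re_comp Phi a) p +i* 'D_X (im_comp Phi a) p)%C.
Proof. by rewrite mxE. Qed.

End SpinConnection.

(** * Derivatives along segments *)

Section Segments.
Variables (R : realType) (n : nat).
Implicit Types (p q v : 'rV[R]_n) (F : 'rV[R]_n -> R).

Lemma derive_along_line F p v (t : R) :
  derivable F (t *: v + p) v ->
  is_derive t 1 (fun s : R => F (s *: v + p)) ('D_v F (t *: v + p)).
Proof.
have e : (fun h : R => h^-1 *: (((fun s : R => F (s *: v + p)) \o shift t) (h *: 1)
    - F (t *: v + p)))
  = (fun h : R => h^-1 *: ((F \o shift (t *: v + p)) (h *: v) - F (t *: v + p))).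
  by apply/funext => h /=; rewrite [h%:A]mulr1 scalerDl addrA.
move=> dF; apply: DeriveDef; first by rewrite /derivable e.
by rewrite /derive e.
Qed.

Lemma derive_translate F p v w : 'D_v (fun q => F (q + w)) p = 'D_v F (p + w).
Proof.
have e : (fun h : R => h^-1 *: (((fun q => F (q + w)) \o shift p) (h *: v)
    - F (p + w))) = (fun h : R => h^-1 *: ((F \o shift (p + w)) (h *: v) - F (p + w))).
  by apply/funext => h /=; rewrite addrA.
by rewrite /derive e.
Qed.

(** Only continuity within [D] is available at the end points, which may lie on
    the boundary of [D]; this is what the mean value theorem asks for. *)
Lemma constant_on_segment F (D : set 'rV[R]_n) p q :
  {within D, continuous F} ->
  (forall t : R, 0 <= t <= 1 -> D (t *: (q - p) + p)) ->
  (forall t : R, 0 < t < 1 -> derivable F (t *: (q - p) + p) (q - p) /\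
     'D_(q - p) F (t *: (q - p) + p) = 0) ->
  F p = F q.
Proof.
move=> cF segD dF; pose g (t : R) := F (t *: (q - p) + p).
have cg : {within `[0, 1], continuous g}.
  apply: (proj2 (@subspace_continuousP R `[0, 1]%classic R g)) => t /=; rewrite in_itv /= => t01.
  have {}cF := proj1 (@subspace_continuousP _ D _ F) cF _ (segD t t01).
  have cseg : (fun s : R => s *: (q - p) + p) @ t --> t *: (q - p) + p.
    have -> : (fun s : R => s *: (q - p) + p) = (fun s : R => s *: (q - p)) + cst p.
      by [].
    by apply: cvgD; [exact: (@scalel_continuous R _ (q - p) t) | exact: cvg_cst].
  move=> W /cF; rewrite /within /= => /cseg cW.
  have cW' : \forall s \near t,
    D (s *: (q - p) + p) -> W (F (s *: (q - p) + p)) := cW.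
  suff : \forall s \near t, s \in `[0, 1] -> W (g s) by [].
  apply: filterS cW' => s WD s01.
  by apply/WD/segD; move: s01; rewrite in_itv.
have dg (t : R) : t \in `]0, 1[%R -> is_derive t 1 g 0.
  rewrite in_itv /= => t01; have [dt <-] := dF t t01.
  exact: derive_along_line.
have [t _] := MVT ltr01 dg cg.
rewrite mul0r => /eqP; rewrite subr_eq0 /g scale1r scale0r add0r subrK.
by move=> /eqP ->.
Qed.

End Segments.

(** * Parallel spinors *)

Lemma complex_eq0 (R : rcfType) (x y : R) : (x +i* y)%C = 0 -> x = 0 /\ y = 0.
Proof. by move=> /eqP; rewrite eq_complex /= => /andP[/eqP -> /eqP ->]. Qed.

Lemma convex_gt (R : realFieldType) (a x y t : R) :
  a <= x -> a < y -> 0 < t <= 1 -> a < t * (y - x) + x.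
Proof.
move=> ax ay /andP[t0 t1]; rewrite -subr_gt0.
have -> : t * (y - x) + x - a = t * (y - a) + (1 - t) * (x - a) by ring.
by rewrite ltr_pwDl ?mulr_gt0 ?mulr_ge0 ?subr_gt0 ?subr_ge0.
Qed.

Lemma convex_lt (R : realFieldType) (a x y t : R) :
  x <= a -> y < a -> 0 < t <= 1 -> t * (y - x) + x < a.
Proof.
rewrite -lerN2 -ltrN2 => ax ay /(convex_gt ax ay); rewrite -ltrN2.
by congr (_ < _); ring.
Qed.

Section Parallel.
Variables (R : realType) (B : R).
Hypothesis B_gt0 : 0 < B.
Local Notation C := R[i].
Implicit Types (Phi : spinor B) (p q X : 'rV[R]_4).
Local Notation f := (eh_f B).

Lemma chart_domain : eh_chart B `<=` eh_domain B.
Proof.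
move=> p [pr /andP[t t'] /andP[h h'] /andP[s s']].
by split; rewrite ?ltW.
Qed.

(** Each bound of the coordinate range is weak at [p] and strict at [q], hence
    strict at every later point of the segment. *)
Lemma segment_chart p q (t : R) : eh_domain B p -> eh_chart B q -> 0 < t <= 1 ->
  eh_chart B (t *: (q - p) + p).
Proof.
move=> [pr /andP[pt pt'] /andP[pf pf'] /andP[ps ps']].
move=> [qr /andP[qt qt'] /andP[qf qf'] /andP[qs qs']] t01.
by split; rewrite ?/rcoord ?/theta ?/phi ?/psi !mxE ?convex_gt ?convex_lt.
Qed.

Lemma valL_domain Phi p (pd : eh_domain B p) :
  'valL_(0 : 'cV[C]_4) Phi p = Phi (SigSub (mem_set pd)).
Proof. exact: (congr1 (fun g => g (SigSub (mem_set pd))) (valLK 0 Phi)). Qed.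

Lemma constant_from_chart (F : 'rV[R]_4 -> R) p q :
  {within eh_domain B, continuous F} ->
  (forall x, eh_chart B x -> differentiable F x) ->
  eh_domain B p -> eh_chart B q ->
  (forall x, eh_chart B x -> 'D_(q - p) F x = 0) -> F p = F q.
Proof.
move=> cF dF pd qc DF; apply: (constant_on_segment cF) => t.
  move=> /andP[]; rewrite le_eqVlt => /orP[/eqP <- _|t0 t1].
    by rewrite scale0r add0r.
  by apply/chart_domain/segment_chart => //; rewrite t0.
move=> /andP[t0 t1].
have xc : eh_chart B (t *: (q - p) + p) by apply: segment_chart; rewrite ?t0 ?ltW.
by split; [exact/diff_derivable/dF | exact: DF].
Qed.

Lemma eh_chartD (h : R) p : 0 <= h -> eh_chart B p ->
  eh_chart B (p + row4 h 0 0 0).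
Proof.
move=> h0 [pr pt pf ps]; split;
  rewrite ?/rcoord ?/theta ?/phi ?/psi !mxE !inordK //= ?addr0 //.
by rewrite ltr_wpDr.
Qed.

Section ParallelSpinor.
Variable Phi : spinor B.
Hypothesis parallel : parallel_spinor Phi.

Lemma parallel_upper p X (k : 'I_2) : eh_chart B p ->
  spinor_deriv X Phi p (lshift 2 k) 0 = 0.
Proof.
move=> pc; have [_ par] := parallel; rewrite -spin_connection_upper //.
by rewrite (par p pc X) mxE.
Qed.

Lemma parallel_lower p X (k : 'I_2) : eh_chart B p ->
  spinor_deriv X Phi p (rshift 2 k) 0
  = \sum_l spin_form B p X k l * 'valL_(0 : 'cV[C]_4) Phi p (rshift 2 l) 0.
Proof.
move=> pc; have [_ par] := parallel; apply/eqP; rewrite -subr_eq0.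
by rewrite -spin_connection_lower // (par p pc X) mxE.
Qed.

Lemma lower_radial_invariant p (k : 'I_2) (h : R) : 0 <= h -> eh_chart B p ->
  'valL_(0 : 'cV[C]_4) Phi (p + row4 h 0 0 0) (rshift 2 k) 0
  = 'valL_(0 : 'cV[C]_4) Phi p (rshift 2 k) 0.
Proof.
move=> h0 pc; have [reg par] := parallel.
have [cre cim dre dim] := reg (rshift 2 k).
have qc := eh_chartD h0 pc; have pd := chart_domain pc.
have e : p + row4 h 0 0 0 - p = row4 h 0 0 0 by rewrite addrC addKr.
have D x : eh_chart B x ->
    'D_(row4 h 0 0 0) (re_comp Phi (rshift 2 k)) x = 0
    /\ 'D_(row4 h 0 0 0) (im_comp Phi (rshift 2 k)) x = 0.
  move=> xc; apply: complex_eq0; rewrite -spinor_derivE.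
  rewrite parallel_lower // spin_form_radial big1 // => l _.
  by rewrite mxE mul0r.
apply/eqP; rewrite eq_complex; apply/andP; split; apply/eqP/esym.
  by apply: (constant_from_chart cre) => // x /D[]; rewrite e.
by apply: (constant_from_chart cim) => // x /D[]; rewrite e.
Qed.

(** The coefficient is [(1 + B / r^4) / 2], strictly decreasing in [r] as
    [B > 0]. *)
Lemma psi_coefficient_injective (r s : R) :
  0 < r -> r < s -> B < r ^+ 4 -> (2 - f r ^+ 2) / 2 <> (2 - f s ^+ 2) / 2.
Proof.
move=> r0 rs Br; have s0 := lt_trans r0 rs.
have rs4 : r ^+ 4 < s ^+ 4 by rewrite ltrXn2r ?ltW // ltW.
rewrite !eh_f_sqr // ?(lt_trans Br) //.
move=> /(mulIf _) -/(_ (invr_neq0 _)) e.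
have {}e : B / r ^+ 4 = B / s ^+ 4 by move: (e); rewrite pnatr_eq0 => /(_ isT); lra.
have : B / s ^+ 4 < B / r ^+ 4 by rewrite ltr_pM2l // ltf_pV2 ?posrE ?exprn_gt0.
by rewrite e ltxx.
Qed.

(** The derivative along [psi] of the lower components is
    [(2 - f(r)^2) / 2 * M_4 Phi].  Moving [p] by one unit in the radial
    direction changes neither the lower components nor their derivatives, but
    it changes the coefficient; hence [M_4 Phi = 0]. *)
Lemma lower_zero p (k : 'I_2) : eh_chart B p ->
  'valL_(0 : 'cV[C]_4) Phi p (rshift 2 k) 0 = 0.
Proof.
move=> pc; have [reg par] := parallel.
pose e : 'rV[R]_4 := row4 1 0 0 0; pose v : 'rV[R]_4 := row4 0 0 0 1.
have qc : eh_chart B (p + e) by exact: eh_chartD ler01 pc.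
have radial x l : eh_chart B x -> 'valL_(0 : 'cV[C]_4) Phi (x + e) (rshift 2 l) 0
    = 'valL_(0 : 'cV[C]_4) Phi x (rshift 2 l) 0.
  exact: lower_radial_invariant ler01.
have D l : spinor_deriv v Phi (p + e) (rshift 2 l) 0
    = spinor_deriv v Phi p (rshift 2 l) 0.
  have shift F := esym (derive_translate F p v e); rewrite !spinor_derivE !shift.
  congr (_ +i* _)%C; apply: near_eq_derive;
    apply: filterS (near_chart pc) => x xc;
    by rewrite /re_comp /im_comp radial.
pose S l := \sum_m cM4 R l m * 'valL_(0 : 'cV[C]_4) Phi p (rshift 2 m) 0.
pose c x := ((2 - f (rcoord x) ^+ 2) / 2)%:C%C.
have E x l : eh_chart B x ->
    spinor_deriv v Phi x (rshift 2 l) 0 = c x *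
      \sum_m cM4 R l m * 'valL_(0 : 'cV[C]_4) Phi x (rshift 2 m) 0.
  move=> xc.
  rewrite parallel_lower // spin_form_psi // mulr_sumr.
  by apply: eq_bigr => m _; rewrite mxE mulrA.
have S0 l : S l = 0.
  have := D l; rewrite !E //.
  under eq_bigr => m _ do rewrite radial //.
  rewrite -/(S l) => /eqP; rewrite -subr_eq0 -mulrBl mulf_eq0 => /orP[|/eqP //].
  rewrite subr_eq0 /c => /eqP [] /esym.
  have [r0 Br] := chart_rcoord B_gt0 pc => h; exfalso.
  have er : rcoord (p + e) = rcoord p + 1 by rewrite /rcoord !mxE inordK.
  by apply: psi_coefficient_injective h; rewrite // er ltrDl.
(* [M_4] is diagonal with entries [i] and [- i]. *)
move: k; apply: ord2_all.
  have := S0 0; rewrite /S !big_ord_recl big_ord0 !mxE /= mul0r !addr0.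
  by move=> /eqP; rewrite mulf_eq0 (negPf (neq0Ci C)) => /eqP.
have := S0 1; rewrite /S !big_ord_recl big_ord0 !mxE /= mul0r add0r addr0.
move=> /eqP; rewrite mulf_eq0 oppr_eq0 (negPf (neq0Ci C)) => /eqP <-.
by congr ('valL_(0 : 'cV[C]_4) Phi p _ 0); apply/val_inj.
Qed.

Lemma parallel_derive0 p X a : eh_chart B p ->
  'D_X (re_comp Phi a) p = 0 /\ 'D_X (im_comp Phi a) p = 0.
Proof.
move=> pc; have [reg par] := parallel.
apply: complex_eq0; rewrite -spinor_derivE.
case: (split_ordP (a : 'I_(2 + 2))) => k ->.
  exact: parallel_upper.
by rewrite [LHS]parallel_lower // big1 // => l _; rewrite lower_zero // mulr0.
Qed.

Lemma parallel_constant p q a : eh_domain B p -> eh_chart B q ->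
  'valL_(0 : 'cV[C]_4) Phi p a 0 = 'valL_(0 : 'cV[C]_4) Phi q a 0.
Proof.
move=> pd qc; have [reg par] := parallel; have [cre cim dre dim] := reg a.
have D x := @parallel_derive0 x (q - p) a.
apply/eqP; rewrite eq_complex; apply/andP; split; apply/eqP.
  by apply: (constant_from_chart cre) => // x /D[].
by apply: (constant_from_chart cim) => // x /D[].
Qed.

End ParallelSpinor.

(** The extension of a constant spinor by zero jumps across the boundary of the
    coordinate range; it is constant near the points of the open chart and
    continuous within the range, which is all that parallelism refers to. *)
Lemma constant_upper_parallel (w : 'cV[C]_4) :
  (forall k : 'I_2, w (rshift 2 k) 0 = 0) ->
  parallel_spinor ((fun=> w) : spinor B).
Proof.
move=> w0; pose Phi : spinor B := fun=> w.
have val p : eh_domain B p -> 'valL_(0 : 'cV[C]_4) Phi p = w.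
  by move=> pd; rewrite valL_domain.
have re a p : eh_domain B p -> complex.Re (w a 0) = re_comp Phi a p.
  by move=> pd; rewrite /re_comp val.
have im a p : eh_domain B p -> complex.Im (w a 0) = im_comp Phi a p.
  by move=> pd; rewrite /im_comp val.
have chart_diff (F : 'rV[R]_4 -> R) c p :
    (forall q, eh_domain B q -> c = F q) -> eh_chart B p -> is_diff p F (fun=> 0).
  move=> cF pc; apply: near_eq_is_diff (is_diff_const p c).
  by apply: filterS (near_chart pc) => q /chart_domain; exact: cF.
have cont (F : 'rV[R]_4 -> R) c :
    (forall q, eh_domain B q -> c = F q) -> {within eh_domain B, continuous F}.
  move=> cF; apply: (@subspace_eq_continuous _ _ _ (cst c)).
    by move=> q; rewrite inE => /cF.
  by move=> q; exact: cst_continuous.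
split.
  move=> a; split.
  - exact: cont (re a).
  - exact: cont (im a).
  - by move=> p pc; have [] := chart_diff _ _ p (re a) pc.
  - by move=> p pc; have [] := chart_diff _ _ p (im a) pc.
move=> p pc X; apply/matrixP => a j; rewrite ord1 [RHS]mxE.
have d0 b : spinor_deriv X Phi p b 0 = 0.
  rewrite spinor_derivE (is_diff_derive X (chart_diff _ _ p (re b) pc)).
  by rewrite (is_diff_derive X (chart_diff _ _ p (im b) pc)).
case: (split_ordP (a : 'I_(2 + 2))) => k ->.
  by rewrite [LHS]spin_connection_upper.
rewrite [LHS]spin_connection_lower // d0 sub0r big1 ?oppr0 // => l _.
by rewrite val ?w0 ?mulr0 //; exact: chart_domain.
Qed.

Definition chart_center : 'rV[R]_4 := row4 (B `^ 4^-1 + 1) (pi / 2) pi pi.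

Lemma chart_center_in : eh_chart B chart_center.
Proof.
have p0 := pi_gt0 R.
split; rewrite ?coord_row4; first by rewrite ltrDl.
- by apply/andP; split; lra.
- by apply/andP; split; lra.
- by apply/andP; split; lra.
Qed.

End Parallel.

Theorem theorem3p1 (R : realType) (B : R) (hB : 0 < B) :
  (forall Phi : eh_domain B -> 'cV[R[i]]_4,
     parallel_spinor (B := B) Phi -> constant_spinor Phi) /\
  subspace_of_dim (V := eh_domain B -> 'cV[R[i]]_4)
    (parallel_spinor (B := B)) 2.
Proof.
pose q := chart_center B; have qc : eh_chart B q := chart_center_in B.
have qd := chart_domain qc; pose q' : eh_domain B := SigSub (mem_set qd).
have const (Phi : spinor B) (x : eh_domain B) a : parallel_spinor Phi ->
    Phi x a 0 = Phi q' a 0.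
  move=> par; have xd : eh_domain B (val x) := set_mem (valP x).
  have := parallel_constant hB par a xd qc.
  rewrite !valL_domain; congr (Phi _ a 0 = Phi _ a 0); exact: val_inj.
split=> [Phi par a|]; first by exists (Phi q' a 0) => x; exact: const.
pose b (k : 'I_2) : spinor B := fun=> delta_mx (lshift 2 k : 'I_(2 + 2)) 0.
have bE (c : 'I_2 -> R[i]) x (l : 'I_2) :
    (\sum_k c k *: b k) x (lshift 2 l) 0 = c l /\
    (\sum_k c k *: b k) x (rshift 2 l) 0 = 0.
  rewrite fct_sumE !summxE; split.
    rewrite (bigD1 l) //= big1 ?addr0; first by rewrite !mxE !eqxx mulr1.
    by move=> k kl; rewrite !mxE eq_lshift eq_sym (negPf kl) mulr0.
  by rewrite big1 // => k _; rewrite !mxE eq_rlshift mulr0.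
exists b; split=> [c c0 l|v].
  by rewrite -(bE c q' l).1 c0 mxE.
split=> [par|[c ->]].
  exists (fun k : 'I_2 => v q' (lshift 2 k) 0).
  apply/funext => x; apply/matrixP => a j; rewrite ord1 const //.
  case: (split_ordP (a : 'I_(2 + 2))) => k ->.
    by rewrite [RHS](bE _ x k).1.
  rewrite [RHS](bE _ x k).2 -(valL_domain v qd).
  exact: lower_zero.
have -> : \sum_k c k *: b k = fun=> (\sum_k c k *: b k) q'.
  by apply/funext => x; rewrite !fct_sumE.
by apply: constant_upper_parallel => // k; rewrite (bE c q' k).2.
Qed.
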